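(* Let $\mathcal X$ be a real linear space, $\mathcal X_0:=\mathcal X\setminus\{0\}$, $\mathcal Y$ a real Banach space, and $r,s,t$ positive integers. Let $\varepsilon>0$ and let $f:\mathcal X\to\mathcal Y$ be a mapping with $f(0)=0$ satisfying $$\left\|r f\!\left(\frac{sx+ty}{r}\right)-s f(x)-t f(y)\right\|\le\varepsilon$$ for all $x,y\in\mathcal X_0$. Then there exists a unique additive mapping $A:\mathcal X\to\mathcal Y$ such that $$\|f(x)-A(x)\|\le\min\left\{\frac{3\varepsilon}{r},\frac{5\varepsilon}{2s},\frac{5\varepsilon}{2t}\right\}+\frac{2\varepsilon}{r}$$ for all $x\in\mathcal X$.
   Context: A map $A$ between linear spaces is additive if $A(x+y)=A(x)+A(y)$ for all $x,y$. *)

(* Defs.v *)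
From HB Require Import structures.
From mathcomp Require Import all_boot all_order all_algebra.
From mathcomp Require Import all_classical all_reals all_analysis.

(* Main.v *)
Require Import Defs.
From HB Require Import structures.
From mathcomp Require Import all_boot all_order all_algebra.
From mathcomp Require Import all_classical all_reals all_analysis.
From mathcomp Require Import ring lra.
Set Implicit Arguments.
Unset Strict Implicit.
Unset Printing Implicit Defensive.
Import Order.TTheory GRing.Theory Num.Theory.
Import numFieldNormedType.Exports.
Local Open Scope ring_scope.

(* Put p u = (r/s) u. Comparing the hypothesis at (p (w + v), y) and (p v, y) with
   y = -(r/t) v, whose combinations are w and 0, gives
   r f(w) = s (f(p(w + v)) - f(p v)) up to 2 eps whenever v and w + v are nonzero.
   Using this three times with a generic v makes f approximately additive, and
   Hyers' direct method yields an additive A with f - A bounded. The same estimate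
   holds for f - A; summing it over v = w, 2w, ..., nw telescopes, and boundedness
   gives |f - A| <= 2 eps / r, already below the required bound. *)

Lemma mulrn_bounded_le0 (R : realType) (c q : R) :
  (forall n, c *+ n <= q) -> c <= 0.
Proof.
move=> h; rewrite leNgt; apply/negP => c0.
have := h (Num.bound `|q / c|); apply/negP; rewrite -ltNge.
rewrite -mulr_natr -ltr_pdivrMl// mulrC.
by apply: le_lt_trans (ler_norm _) _; apply: archi_boundP; exact: normr_ge0.
Qed.

Lemma morphD_mulrn (U V : zmodType) (A : U -> V) :
  {morph A : x y / x + y} -> forall x n, A (x *+ n) = A x *+ n.
Proof.
move=> AD x; have A0 : A 0 = 0 by apply: (addrI (A 0)); rewrite -AD !addr0.
by elim=> [|n IH]; rewrite ?mulr0n// !mulrS AD IH.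
Qed.

(** The difference of [A] and [B] is additive and bounded by [a + b], so all natural multiples of
    [|A x - B x|] stay below [a + b], which forces it to vanish. *)
Lemma bounded_additive_unique (R : realType) (U : zmodType) (V : normedModType R)
    (f A B : U -> V) (a b : R) :
  {morph A : x y / x + y} -> {morph B : x y / x + y} ->
  (forall x, `|f x - A x| <= a) -> (forall x, `|f x - B x| <= b) -> A =1 B.
Proof.
move=> AD BD fA fB x; apply/eqP; rewrite -subr_eq0 -normr_le0.
apply: (@mulrn_bounded_le0 _ _ (a + b)) => n.
rewrite -normrMn mulrnBl -!morphD_mulrn//.
rewrite -[A _ - _](subrKA (f (x *+ n))) -[A _ - _]opprB.
by rewrite (le_trans (ler_normD _ _))// normrN lerD.
Qed.

Lemma dyadic_cauchy_cvg (R : realType) (V : completeNormedModType R)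
    (u : nat -> V) (K : R) :
  (forall n, `|u n.+1 - u n| <= K / 2 ^+ n.+1) ->
  exists l, forall n, `|l - u n| <= K / 2 ^+ n.
Proof.
move=> hu.
(* Keeping the exact geometric sum, with its subtracted tail, is what lets the induction on [m]
   close. *)
have dist m n : `|u (m + n)%N - u n| <= K / 2 ^+ n - K / 2 ^+ (m + n).
  elim: m => [|m IH]; first by rewrite !subrr normr0.
  rewrite addSn -[u _ - _](subrKA (u (m + n)%N)).
  rewrite (le_trans (ler_normD _ _))// (le_trans (lerD (hu _) IH))//.
  rewrite exprS invfM; lra.
have K0 : 0 <= K.
  by have := le_trans (normr_ge0 _) (hu 0); rewrite pmulr_lge0.
have dist' m n : (n <= m)%N -> `|u m - u n| <= K / 2 ^+ n.
  move=> /subnK <-; rewrite (le_trans (dist _ _))// gerBl divr_ge0//.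
have cu : cvgn u.
  apply/cauchy_cvgP/cauchy_exP => e e0.
  (* Any [N] above [|K / e|] works, because [N < 2 ^ N]. *)
  have [N hN] : exists N : nat, K / 2 ^+ N < e.
    exists (Num.bound `|K / e|).
    rewrite ltr_pdivrMr ?exprn_gt0// mulrC -ltr_pdivrMr//.
    apply: le_lt_trans (ler_norm _) _.
    apply: lt_trans (archi_boundP _) _; first exact: normr_ge0.
    by rewrite -natrX ltr_nat ltn_expl.
  exists (u N); exists N => // m /= Nm.
  by rewrite -ball_normE /= distrC (le_lt_trans (dist' _ _ Nm)).
exists (limn u) => n.
have cn : ((fun m => `|u m - u n|) @ \oo --> `|limn u - u n|)%classic.
  by apply: cvg_norm; apply: cvgB => //; exact: cvg_cst.
rewrite -(cvg_lim _ cn)//; apply: limr_le; first by apply/cvg_ex; exists (`|limn u - u n|).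
by exists n => // m /= nm; exact: dist'.
Qed.

(** [A x] is the limit of [g (2^n x) / 2^n]. Consecutive terms differ by the additivity defect of
    [g] at the pair [(2^n x, 2^n x)], divided by [2^(n+1)]. *)
Lemma hyers (R : realType) (U : zmodType) (V : completeNormedModType R)
    (g : U -> V) (K : R) :
  (forall x y, `|g (x + y) - g x - g y| <= K) ->
  exists A : U -> V, {morph A : x y / x + y} /\ forall x, `|g x - A x| <= K.
Proof.
move=> hg; pose u x n : V := (2 ^+ n : R)^-1 *: g (x *+ 2 ^ n).
have hu x n : `|u x n.+1 - u x n| <= K / 2 ^+ n.+1.
  have -> : u x n.+1 - u x n = (2 ^+ n.+1 : R)^-1 *:
     (g (x *+ 2 ^ n + x *+ 2 ^ n) - g (x *+ 2 ^ n) - g (x *+ 2 ^ n)).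
    rewrite /u expnS mul2n -addnn mulrnDr -addrA -opprD [RHS]scalerBr.
    congr (_ - _); rewrite -[in RHS](mulr2n (g _)) -(scaler_nat 2 (g _)) scalerA.
    by rewrite exprS invfM mulrAC mulVf ?mul1r// pnatr_eq0.
  by rewrite normrZ ger0_norm ?invr_ge0 ?exprn_ge0// mulrC ler_wpM2r ?invr_ge0 ?exprn_ge0.
have [A hA] := choice (fun x => dyadic_cauchy_cvg (hu x)).
exists A; split=> [x y|x]; last first.
  by have := hA x 0; rewrite /u expr0 invr1 scale1r mulr1 distrC.
apply/eqP; rewrite -subr_eq0 -normr_le0.
(* Four errors of size [K / 2^n] occur: the approximation of [A] by [u] at [x + y], [x] and [y], and
   the additivity defect of [u]. Since [n < 2^n], the factor [n] can be raised to [2^n]. *)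
apply: (@mulrn_bounded_le0 _ _ (K *+ 4)) => n.
apply: (@le_trans _ _ (`|A (x + y) - (A x + A y)| *+ 2 ^ n)).
  by rewrite ler_wpMn2l// ltnW// ltn_expl.
rewrite -mulr_natr -ler_pdivlMr ?ltr0n ?expn_gt0// natrX.
have hd : `|u (x + y) n - (u x n + u y n)| <= K / 2 ^+ n.
  rewrite /u -scalerDr -scalerBr normrZ ger0_norm ?invr_ge0 ?exprn_ge0//.
  by rewrite mulrC ler_wpM2r ?invr_ge0 ?exprn_ge0// mulrnDl opprD addrA.
have -> : A (x + y) - (A x + A y) =
    (A (x + y) - u (x + y) n) + (u (x + y) n - (u x n + u y n))
    - ((A x - u x n) + (A y - u y n)).
  by rewrite subrKA [in RHS]addrACA -[- u x n - _]opprD [in RHS]opprB subrKA.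
have -> : K *+ 4 / 2 ^+ n =
    (K / 2 ^+ n + K / 2 ^+ n) + (K / 2 ^+ n + K / 2 ^+ n) by ring.
apply: le_trans (ler_normB _ _) _.
rewrite lerD// (le_trans (ler_normD _ _))//; exact: lerD.
Qed.

Lemma shift_estimate (R : realType) (X : lmodType R) (Y : normedModType R)
    (r s t : nat) (eps : R) (f : X -> Y) (v w : X) :
  (0 < r)%N -> (0 < s)%N -> (0 < t)%N -> f 0 = 0 ->
  (forall x y : X, x != 0 -> y != 0 ->
    `| r%:R *: f (r%:R^-1 *: (s%:R *: x + t%:R *: y))
       - s%:R *: f x - t%:R *: f y | <= eps) ->
  v != 0 -> w + v != 0 ->
  `|r%:R *: f w
    - s%:R *: (f ((r%:R / s%:R) *: (w + v)) - f ((r%:R / s%:R) *: v))| <= eps *+ 2.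
Proof.
move=> hr hs ht f0 hf v0 wv0.
have [r0 s0 t0] : [/\ r%:R != 0 :> R, s%:R != 0 :> R & t%:R != 0 :> R].
  by rewrite !pnatr_eq0 -!lt0n.
have p0 (k : nat) (z : X) : k%:R != 0 :> R -> z != 0 -> (r%:R / k%:R : R) *: z != 0.
  by move=> k0 z0; rewrite scaler_eq0 negb_or z0 mulf_neq0 ?invr_neq0.
(* Used at [u = w + v] and at [u = v]. The value of [f] at [-(r/t) v] is common to both instances
   and cancels on subtraction. *)
have E (u : X) : r%:R^-1 *: (s%:R *: ((r%:R / s%:R) *: u)
    + t%:R *: ((r%:R / t%:R) *: - v)) = u - v :> X.
  by rewrite !scalerA !(mulrC _ (r%:R / _)) !divfK// -scalerDr scalerA mulVf ?scale1r.
have := hf _ _ (p0 s _ s0 wv0) (p0 t (- v) t0 _).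
have := hf _ _ (p0 s _ s0 v0) (p0 t (- v) t0 _).
rewrite oppr_eq0 !E addrK subrr f0 scaler0 => /(_ v0) h1 /(_ v0) h2.
rewrite mulr2n; apply: le_trans (lerD h2 h1); apply: le_trans (ler_normB _ _).
rewrite le_eqVlt; apply/predU1l/congr1.
set a := f (_ *: (w + v)); set b := f (_ *: v); set c := f (_ *: - v).
by rewrite sub0r scalerBr [in RHS]opprB subrKA opprK opprB addrAC -addrA.
Qed.

(** The choice [v = w] fails only for [z = -w] or [z = -2w]. In these cases [v = 3w] turns all three
    vectors into positive multiples of [w]. *)
Lemma exists_shift (R : realType) (X : lmodType R) (w z : X) : w != 0 ->
  exists v : X, [/\ v != 0, z + v != 0 & w + (z + v) != 0].
Proof.
move=> w0; have wn k : w *+ k.+1 != 0.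
  by rewrite -(@scaler_nat R) scaler_eq0 pnatr_eq0.
have [zw|zw] := eqVneq (z + w) 0.
  have E : z + w *+ 3 = w *+ 2 by rewrite mulrSr addrCA zw addr0.
  by exists (w *+ 3); rewrite E -mulrS !wn.
have [wzw|wzw] := eqVneq (w + (z + w)) 0; last by exists w.
have E : z + w *+ 3 = w by rewrite mulrS mulr2n !addrA (addrC (z + w)) wzw add0r.
by exists (w *+ 3); rewrite E -mulr2n !wn.
Qed.

Theorem theorem4p3 (R : realType) (X : lmodType R)
  (Y : completeNormedModType R) (r s t : nat)
  (hr : (0 < r)%N) (hs : (0 < s)%N) (ht : (0 < t)%N)
  (eps : R) (heps : 0 < eps) (f : X -> Y) (hf0 : f 0 = 0)
  (hf : forall x y : X, x != 0 -> y != 0 ->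
    `| r%:R *: f (r%:R^-1 *: (s%:R *: x + t%:R *: y))
       - s%:R *: f x - t%:R *: f y | <= eps) :
  exists! A : X -> Y,
    {morph A : x y / x + y} /\
    forall x : X,
      `| f x - A x | <=
        Num.min (3 * eps / r%:R)
          (Num.min (5 * eps / (2 * s%:R)) (5 * eps / (2 * t%:R)))
        + 2 * eps / r%:R.
Proof.
have [r0 s0] : 0 < r%:R :> R /\ 0 < s%:R :> R by rewrite !ltr0n.
pose p (u : X) := (r%:R / s%:R : R) *: u.
have pD u v : p (u + v) = p u + p v by exact: scalerDr.
have shift v w : v != 0 -> w + v != 0 ->
    `|r%:R *: f w - s%:R *: (f (p (w + v)) - f (p v))| <= eps *+ 2.
  exact: shift_estimate hf.
have [A [AD fA]] : exists A : X -> Y, {morph A : x y / x + y} /\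
    forall x, `|f x - A x| <= r%:R^-1 * (eps *+ 6).
  apply: hyers => w z; have [->|w0] := eqVneq w 0.
    by rewrite add0r hf0 subr0 subrr normr0 mulr_ge0 ?invr_ge0 ?mulrn_wge0 ?ltW.
  have [v [v0 zv wzv]] := exists_shift z w0.
  rewrite ler_pdivlMl// -[X in X * _]ger0_norm ?ler0n// -normrZ.
  (* The shift from [v] to [z + v] followed by the shift from [z + v] to [w + z + v] is the shift
     from [v] by [w + z], so the [p]-terms cancel. Three errors [eps *+ 2] give the constant
     [eps *+ 6]. *)
  have h1 := shift _ _ v0 zv.
  have h2 := shift _ _ zv wzv.
  have h3 := shift v (w + z) v0; rewrite -addrA in h3; move: {h3}(h3 wzv) => h3.
  rewrite -addrA -opprD scalerBr scalerDr.
  have E : s%:R *: (f (p (w + (z + v))) - f (p (z + v)))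
      + s%:R *: (f (p (z + v)) - f (p v))
      = s%:R *: (f (p (w + (z + v))) - f (p v)).
    by rewrite -scalerDr subrKA.
  have -> : eps *+ 6 = eps *+ 2 + (eps *+ 2 + eps *+ 2) by ring.
  apply: le_trans (lerD h3 (lerD h2 h1)).
  apply: le_trans (lerD (lexx _) (ler_normD _ _)).
  apply: le_trans (ler_normB _ _); rewrite le_eqVlt; apply/predU1l/congr1.
  by rewrite addrACA -opprD E opprB subrKA.
(* [A] satisfies the shift relation without error, so [f - A] inherits the estimate with the same
   [eps *+ 2]. *)
have Ap w : r%:R *: A w = s%:R *: A (p w).
  rewrite !scaler_nat -!(morphD_mulrn AD); congr A.
  by rewrite -2!(@scaler_nat R X) /p scalerA mulrC divfK ?gt_eqF.
have bound x : `|f x - A x| <= 2 * eps / r%:R.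
  have [->|x0] := eqVneq x 0.
    by rewrite hf0 (morphD_mulrn AD 0 0 : A 0 = 0) subrr normr0 divr_ge0 ?mulr_ge0 ?ltW.
  pose h x := f x - A x.
  set K := r%:R^-1 * _ in fA.
  (* The sum starts at [v = x], as [shift] excludes [v = 0]; hence the index [n.+1]. *)
  have tele n : `|(r%:R *: h x) *+ n - s%:R *: (h (p (x *+ n.+1)) - h (p x))| <= eps *+ 2 *+ n.
    elim: n => [|n IH]; first by rewrite !mulr0n mulr1n subrr scaler0 subrr normr0.
    have xn k : x *+ k.+1 != 0 by rewrite -(@scaler_nat R) scaler_eq0 pnatr_eq0.
    have := shift (x *+ n.+1) x (xn n); rewrite -mulrS => /(_ (xn _)) hn.
    rewrite [_ *+ n.+1]mulrSr [eps *+ 2 *+ _]mulrSr.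
    apply: le_trans (lerD IH hn); apply: le_trans (ler_normD _ _).
    rewrite le_eqVlt; apply/predU1l/congr1.
    have E : r%:R *: f x - s%:R *: (f (p (x *+ n.+2)) - f (p (x *+ n.+1))) =
        r%:R *: h x - s%:R *: (h (p (x *+ n.+2)) - h (p (x *+ n.+1))).
      have -> : h (p (x *+ n.+2)) - h (p (x *+ n.+1)) =
          f (p (x *+ n.+2)) - f (p (x *+ n.+1)) - A (p x).
        rewrite /h [X in A (p X)]mulrS pD AD (opprD (f _)) [LHS]addrACA opprK.
        by rewrite [- (A _ + _)]opprD subrK.
      by rewrite /h (scalerBr _ (f x)) Ap [in RHS]scalerBr [in RHS]opprB subrKA.
    by rewrite E addrACA -opprD -scalerDr [in RHS](addrC (h _ - _)) subrKA.
  rewrite ler_pdivlMr// -subr_le0.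
  (* The crude bound [K] only controls the two end terms of the telescoped sum, independently of
     [n], so it disappears from the final estimate. *)
  apply: (@mulrn_bounded_le0 _ _ (s%:R * (K + K))) => n.
  rewrite mulrnBl lerBlDr.
  have -> : `|f x - A x| * r%:R *+ n = `|(r%:R *: h x) *+ n|.
    by rewrite normrMn normrZ ger0_norm ?ler0n// mulrC.
  rewrite -[X in `|X|](subrK (s%:R *: (h (p (x *+ n.+1)) - h (p x)))).
  rewrite (le_trans (ler_normD _ _))// addrC lerD//; last by rewrite (mulr_natl eps 2).
  rewrite normrZ ger0_norm ?ler0n// ler_wpM2l ?ler0n//.
  by rewrite (le_trans (ler_normB _ _))// lerD// fA.
have ge0 (k : R) (m : R) : 0 <= k -> 0 <= m -> 0 <= k * eps / m.
  by move=> k0 m0; rewrite divr_ge0// mulr_ge0// ltW.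
exists A; split=> [|B [BD fB]].
  split=> // x; rewrite (le_trans (bound x))// lerDr !le_min !ge0// mulr_ge0//.
apply/funext; exact: bounded_additive_unique AD BD bound fB.
Qed.
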